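(* Let $q=2^n$ with $n$ a positive integer and let $\varphi\in\mathbb{F}_q(x)$ be a rational function of degree $3$. (1) If $\varphi$ is a permutation rational function, then it is equivalent to a function of the form $\frac{x^3+a_2x^2+a_1x}{x^2+x+b_0}$ for some $a_1,a_2,b_0\in\mathbb{F}_q$ with $\mathrm{Tr}_{\mathbb{F}_q/\mathbb{F}_2}(b_0)=1$. (2) For $a_1,a_2,b_0\in\mathbb{F}_q$, the function $\frac{x^3+a_2x^2+a_1x}{x^2+x+b_0}$ is a permutation rational function if and only if $\mathrm{Tr}_{\mathbb{F}_q/\mathbb{F}_2}(b_0)=1$, $a_1=b_0+\frac1{b_0}$ and $a_2=1+\frac1{b_0}$.
   Context: A permutation rational function is a $\varphi\in\mathbb{F}_q(x)$ inducing a bijection of $\mathbb{P}^1(\mathbb{F}_q)$; the degree of $f/g$ with $f,g$ coprime is $\max(\deg f,\deg g)$. Two rational functions $\varphi,\psi$ are equivalent if there exist Möbius transformations $m_1,m_2=\frac{ax+b}{cx+d}$ ($a,b,c,d\in\mathbb{F}_q$, $ad-bc\ne0$) with $m_1\circ\varphi\circ m_2=\psi$.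
   Formalization: In (2) the forward direction is stated for functions of degree 3, as in the opening sentence; without this it fails, e.g. for Tr(b0)=1, a1=b0, a2=1 the fraction equals x, a permutation. In the converse, degree 3 is proved. *)

(* Defs.v *)
From mathcomp Require Import all_boot all_algebra.

Set Implicit Arguments.
Unset Strict Implicit.
Unset Printing Implicit Defensive.

Import GRing.Theory.
Local Open Scope ring_scope.
Local Open Scope quotient_scope.

Notation ratfun F := {fraction {poly F}}.
Notation "p %:F" := (@FracField.tofrac _ p) : ring_scope.

Section RationalFunctions.

Variable F : fieldType.
Implicit Types (f g : ratfun F).

(* Coprime numerator and denominator; they are determined by [f] up to a common
   nonzero scalar, on which nothing below depends. *)
Definition rnum f : {poly F} :=
  \n_(repr f) %/ gcdp \n_(repr f) \d_(repr f).

Definition rden f : {poly F} :=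
  \d_(repr f) %/ gcdp \n_(repr f) \d_(repr f).

Definition rdeg f : nat := maxn (size (rnum f)).-1 (size (rden f)).-1.

(* The projective line P^1(F), with [None] the point at infinity. *)
Definition proj_line : Type := option F.

(* The value at infinity is [1 : 0] mapped by the homogenizations, in degree
   [rdeg f], of numerator and denominator. *)
Definition reval f (x : proj_line) : proj_line :=
  let: (u, v) :=
    if x is Some a then ((rnum f).[a], (rden f).[a])
    else ((rnum f)`_(rdeg f), (rden f)`_(rdeg f)) in
  if v == 0 then None else Some (u / v).

Definition permutation_ratfun f : Prop := bijective (reval f).

(* Composition [f o g], i.e. substitution of [g] for the variable of [f]. It is
   meaningful as soon as [g] is nonconstant, since the denominator
   [(rden f)(g)] is then nonzero; if it vanishes the value is 0 by convention. *)
Definition rcomp f g : ratfun F :=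
  (map_poly (@FracField.tofrac _ \o polyC) (rnum f)).[g] /
  (map_poly (@FracField.tofrac _ \o polyC) (rden f)).[g].

Definition is_moebius (m : ratfun F) : Prop :=
  exists a b c d : F,
    a * d - b * c != 0 /\
    m = (a *: 'X + b%:P)%:F / (c *: 'X + d%:P)%:F.

Definition ratfun_equiv f g : Prop :=
  exists m1 m2 : ratfun F,
    [/\ is_moebius m1, is_moebius m2 & rcomp m1 (rcomp f m2) = g].

Lemma rden_neq0 f : rden f != 0.
Proof.
rewrite /rden; have d0 := denom_ratioP (repr f).
by rewrite dvdp_div_eq0 ?dvdp_gcdr.
Qed.

Lemma coprimep_rnum_rden f : coprimep (rnum f) (rden f).
Proof.
rewrite /rnum /rden; apply: coprimep_div_gcd.
by rewrite denom_ratioP orbT.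
Qed.

Lemma ratfun_numdenE f : f = (rnum f)%:F / (rden f)%:F.
Proof.
have d0 := denom_ratioP (repr f).
set n := \n_(repr f) in d0 *; set d := \d_(repr f) in d0 *.
have fE : f = n%:F / d%:F.
  have dF : d%:F != 0 :> ratfun F by rewrite tofrac_eq0.
  apply: (mulIf dF); rewrite divfK // -[f in LHS]reprK -[repr f in LHS]Ratio_numden.
  unlock FracField.tofrac; apply/eqP; rewrite !piE /= /FracField.equivf /=.
  by rewrite /FracField.mulf !numden_Ratio ?mulf_neq0 ?oner_neq0 // !mulr1 mulrC.
apply/eqP; rewrite [X in X == _]fE eqr_div ?tofrac_eq0 ?rden_neq0 //.
rewrite -!tofracM tofrac_eq /rnum /rden -/n -/d -{1}(divpK (dvdp_gcdl n d)).
by rewrite -mulrA [gcdp n d * _]mulrC divpK ?dvdp_gcdr.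
Qed.

Definition cubic_form (a1 a2 b0 : F) : ratfun F :=
  ('X^3 + a2 *: 'X^2 + a1 *: 'X)%:F / ('X^2 + 'X + b0%:P)%:F.

(* Trace of F_{2^n} over F_2, its values viewed in F_{2^n}; [F] is assumed to
   have 2^n elements. *)
Definition trace2 (n : nat) (b : F) : F := \sum_(i < n) b ^+ (2 ^ i).

End RationalFunctions.

(* Main.v *)
Require Import Defs.
From mathcomp Require Import all_boot all_algebra.
From mathcomp Require Import all_field zify.
From Stdlib Require Import Ring Field Ring_theory Field_theory.

(* A function of degree 3 that permutes P^1(F_q) is moved by Moebius maps so
   that infinity is fixed; its denominator then has no root, so it is an
   irreducible quadratic or a constant, and in the polynomial case another
   point, at which the remaining quadratic factor is separable, is sent to
   infinity instead.

   For N / D = (x^3 + a2 x^2 + a1 x) / (x^2 + x + b), write x + y = s and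
   x y = p: N(x) D(y) = N(y) D(x) with x <> y becomes the equation
   p^2 + p (s + A) + b s^2 + a2 b s + a1 b = 0 with A = b + a1 + a2, and x, y
   exist in F_q iff s <> 0 and Tr (p / s^2) = 0. Solving this quadratic in p by
   additive Hilbert 90 turns injectivity into the statement that two functions
   of the form Tr (C / (s + A)) and Tr (k / s) are never both 1; each being 1
   exactly q/2 times, they are complementary. This forces A = 1. The same
   counting, applied to Tr (C / e) and Tr e, which both vanish at e = 0, then
   forces b (a2 + 1) = 1. No Weil bound is needed. *)

Set Implicit Arguments.
Unset Strict Implicit.
Unset Printing Implicit Defensive.

Import GRing.Theory.
Local Open Scope ring_scope.

(** * Deciding field identities in characteristic 2 *)

Section CharTwoRing.

Variable F : fieldType.
Hypothesis two0 : (1 + 1 : F) = 0.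

(* Copies of the field operations with fixed head symbols: the [ring] tactic
   recognises operations syntactically, whereas canonical structures present
   them through many convertible instances. Coefficients in F_2 let [ring] and
   [field] decide identities that hold only in characteristic 2. *)
Definition fzero : F := 0.
Definition fone : F := 1.
Definition fadd (x y : F) : F := x + y.
Definition fmul (x y : F) : F := x * y.
Definition fopp (x : F) : F := - x.
Definition fsub (x y : F) : F := x - y.
Definition finv (x : F) : F := x^-1.
Definition fdiv (x y : F) : F := x / y.
Definition fexp (x : F) (k : nat) : F := x ^+ k.
Definition fatom (x : F) : F := x.
Definition fbool (b : bool) : F := if b then 1 else 0.

Lemma addxx (x : F) : x + x = 0.
Proof. by rewrite -[x]mulr1 -mulrDr two0 mulr0. Qed.

Lemma opp_char2 (x : F) : - x = x.
Proof. by apply/eqP; rewrite -subr_eq0 -opprD addxx oppr0. Qed.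

Lemma char2_field_theory :
  field_theory fzero fone fadd fmul fsub fopp fdiv finv (@eq F).
Proof.
split=> [||//|x /eqP nz]; last exact: mulVf; last by apply/eqP; exact: oner_neq0.
split=> //; [exact: add0r|exact: addrC|exact: addrA|exact: mul1r|exact: mulrC
  |exact: mulrA|exact: mulrDl|exact: subrr].
Qed.

Lemma char2_ring_morph :
  ring_morph fzero fone fadd fmul fsub fopp (@eq F)
    false true xorb andb xorb id eqb fbool.
Proof.
split=> // [[] []|[] []|[] []|[]|[] []] //=;
  rewrite /fadd /fsub /fmul /fopp ?opp_char2 ?oppr0 ?addr0 ?add0r ?addxx
    ?mulr0 ?mulr1 //; exact: opp_char2.
Qed.

Lemma char2_power_theory :
  power_theory fone fmul (@eq F) BinNat.N.to_nat fexp.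
Proof.
split=> x [|p] //=; rewrite /fexp /=.
elim: p => [p IH|p IH|] /=; last by rewrite expr1.
- by rewrite Pnat.Pos2Nat.inj_xI exprS -IH multE mul2n -addnn exprD.
- by rewrite Pnat.Pos2Nat.inj_xO -IH multE mul2n -addnn exprD.
Qed.

End CharTwoRing.

Ltac f2_coef t :=
  match t with
  | fzero _ => constr:(false)
  | fone _ => constr:(true)
  | _ => constr:(InitialRing.NotConstant)
  end.

Ltac f2_pow t :=
  match isnatcst t with
  | true => eval compute in (BinNat.N.of_nat t)
  | false => constr:(InitialRing.NotConstant)
  end.

Ltac char2_reify F t :=
  match t with
  | @GRing.zero _ => constr:(fzero F)
  | @GRing.one _ => constr:(fone F)
  | GRing.add ?a (GRing.opp ?b) =>
    let a' := char2_reify F a in let b' := char2_reify F b in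
    constr:(@fsub F a' b')
  | GRing.add ?a ?b =>
    let a' := char2_reify F a in let b' := char2_reify F b in
    constr:(@fadd F a' b')
  | GRing.mul ?a (GRing.inv ?b) =>
    let a' := char2_reify F a in let b' := char2_reify F b in
    constr:(@fdiv F a' b')
  | GRing.mul ?a ?b =>
    let a' := char2_reify F a in let b' := char2_reify F b in
    constr:(@fmul F a' b')
  | GRing.opp ?a => let a' := char2_reify F a in constr:(@fopp F a')
  | GRing.inv ?a => let a' := char2_reify F a in constr:(@finv F a')
  | GRing.exp ?a ?k =>
    let a' := char2_reify F a in constr:(@fexp F a' k)
  | _ => constr:(@fatom F t)
  end.

Ltac char2_prepare F :=
  match goal with
  | |- @eq _ ?a ?b =>
    let a' := char2_reify F a in let b' := char2_reify F b in
    change (@eq (GRing.Field.sort F) a' b')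
  end.

Ltac char2_unfold :=
  unfold fzero, fone, fadd, fmul, fopp, fsub, finv, fdiv, fexp, fatom in *.

Ltac ring_char2 K := char2_prepare K; ring.

Ltac field_char2 K := char2_prepare K; field; char2_unfold;
  repeat split; try (apply/eqP; by []).


(** * The absolute trace on a finite field of characteristic 2 *)

Section Trace.

Variables (n : nat) (F : finFieldType).
Hypotheses (n_gt0 : (0 < n)%N) (cardF : #|F| = (2 ^ n)%N).

Local Notation Tr := (@trace2 F n).

Lemma pchar2 : 2%N \in [pchar F].
Proof. exact: (card_finPcharP cardF). Qed.

Lemma two0 : 1 + 1 = 0 :> F.
Proof. by have := pcharf0 pchar2. Qed.

Lemma expr_card (x : F) : x ^+ (2 ^ n) = x.
Proof. by rewrite -cardF expf_card. Qed.

Lemma expr2X (x : F) k : (x ^+ (2 ^ k)) ^+ 2 = x ^+ (2 ^ k.+1).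
Proof. by rewrite -exprM expnSr. Qed.

Lemma exprD2X (x y : F) k : (x + y) ^+ (2 ^ k) = x ^+ (2 ^ k) + y ^+ (2 ^ k).
Proof.
by apply: exprDn_pchar; rewrite pnatX pnatE // pchar2.
Qed.

Lemma sqrt_exists (x : F) : exists r, r ^+ 2 = x.
Proof.
by exists (x ^+ (2 ^ n.-1)); rewrite expr2X prednK // expr_card.
Qed.

Lemma sqr_sum m (f : 'I_m -> F) :
  (\sum_(i < m) f i) ^+ 2 = \sum_(i < m) f i ^+ 2.
Proof.
apply: (big_morph (fun x : F => x ^+ 2)) => [x y|]; last by rewrite expr0n.
exact: (exprD2X x y 1).
Qed.

Lemma trace2D x y : Tr (x + y) = Tr x + Tr y.
Proof. by rewrite /trace2 -big_split; apply: eq_bigr => i _; rewrite exprD2X. Qed.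

(** Squaring permutes the summands cyclically, because [x ^+ (2 ^ n) = x]. *)
Lemma trace2_sqr x : Tr (x ^+ 2) = Tr x.
Proof.
rewrite /trace2; case: n n_gt0 expr_card => // m _ xq.
rewrite big_ord_recr big_ord_recl /= addrC -exprM -expnS xq expn0 expr1.
by congr (_ + _); apply: eq_bigr => i _; rewrite -exprM -expnS.
Qed.

Lemma sqr_trace2 x : Tr x ^+ 2 = Tr x.
Proof.
rewrite -[RHS]trace2_sqr /trace2 sqr_sum; apply: eq_bigr => i _.
by rewrite -!exprM mulnC.
Qed.

Lemma trace2_01 x : (Tr x == 0) || (Tr x == 1).
Proof. by rewrite -[_ == 1]subr_eq0 -mulf_eq0 mulrBr mulr1 -expr2 sqr_trace2 subrr. Qed.

Lemma trace2_0 : Tr 0 = 0.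
Proof. by apply: (addIr (Tr 0)); rewrite -trace2D !add0r. Qed.

Lemma trace2_AS t : Tr (t ^+ 2 + t) = 0.
Proof. by rewrite trace2D trace2_sqr (addxx two0). Qed.

Lemma poly_vanish (p : {poly F}) :
  (size p <= 2 ^ n)%N -> (forall x, p.[x] = 0) -> p = 0.
Proof.
move=> sz p0; apply: contraTeq sz => nz; rewrite -ltnNge -cardF cardE.
by apply: max_poly_roots; rewrite ?enum_uniq //; apply/allP=> x _; apply/rootP.
Qed.

(** Otherwise the trace polynomial, of degree below q, would vanish on all of F, although its
    coefficient of X is 1. *)
Lemma trace2_onto : exists th, Tr th = 1.
Proof.
case: (pickP (fun x => Tr x == 1)) => [th /eqP|no1]; first by exists th.
pose p : {poly F} := \sum_(i < n) 'X^(2 ^ i).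
have p0 : p = 0.
  apply: poly_vanish => [|x].
    apply: leq_trans (size_sum _ _ _) _; apply/bigmax_leqP => i _.
    by rewrite size_polyXn ltn_exp2l.
  have := trace2_01 x; rewrite no1 orbF => /eqP <-; rewrite horner_sum.
  by apply: eq_bigr => i _; rewrite hornerXn.
have : p`_1 = 1.
  rewrite coef_sum (bigD1 (Ordinal n_gt0)) //= coefXn eqxx big1 ?addr0 // => i.
  by rewrite -val_eqE /= coefXn -[1%N in X in _ -> X]/(2 ^ 0)%N eqn_exp2l // eq_sym => /negPf->.
by rewrite p0 coef0 => /esym/eqP; rewrite oner_eq0.
Qed.

(* The explicit solution of additive Hilbert 90 attached to an element [th] of
   trace 1. *)
Lemma hilbert90 x : Tr x = 0 -> exists t, t ^+ 2 + t = x.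
Proof.
move=> trx; have [th trth] := trace2_onto.
pose S (i : nat) : F := \sum_(j < i) x ^+ (2 ^ j).
have S_S i : S i ^+ 2 = S i.+1 + x.
  rewrite /S sqr_sum big_ord_recl /= expr1 addrAC (addxx two0) add0r.
  by apply: eq_bigr => j _; rewrite expr2X.
exists (\sum_(i < n) S i * th ^+ (2 ^ i)).
rewrite sqr_sum.
have -> : \sum_(i < n) (S i * th ^+ (2 ^ i)) ^+ 2
    = \sum_(i < n) S i.+1 * th ^+ (2 ^ i.+1) + x * Tr (th ^+ 2).
  rewrite /trace2 mulr_sumr -big_split; apply: eq_bigr => i _ /=.
  by rewrite exprMn S_S expr2X mulrDl -exprM -expnS.
rewrite trace2_sqr trth mulr1 addrAC -[RHS]add0r; congr (_ + _).
(* Shifting the index changes the sum only by boundary terms; for [m = n] both vanish, as [S 0] is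
   empty and [S n] is [Tr x]. *)
have eqS m : \sum_(i < m) S i.+1 * th ^+ (2 ^ i.+1) + S 0 * th ^+ (2 ^ 0)
    = \sum_(i < m) S i * th ^+ (2 ^ i) + S m * th ^+ (2 ^ m).
  elim: m => [|m IH]; first by rewrite !big_ord0.
  by rewrite !big_ord_recr /= addrAC IH.
have := eqS n; rewrite /S big_ord0 mul0r addr0 -/(Tr x) trx mul0r addr0 => ->.
exact: (addxx two0).
Qed.

(* Each of [f s] and [g s] has trace 1 for exactly half of the [s], so these two
   sets can only be disjoint by being complementary. *)
Lemma trace2_complementary (f g : F -> F) : injective f -> injective g ->
  (forall s, Tr (f s) = 1 -> Tr (g s) = 1 -> False) ->
  forall s, Tr (f s) + Tr (g s) = 1.
Proof.
move=> injf injg dis; have [th trth] := trace2_onto.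
have half (h : F -> F) : injective h -> forall e : F, 
    #|[set s | Tr (h s) == e]| = #|[set s : F | Tr s == e]|.
  move=> injh e; have [h' hK h'K] := injF_bij injh.
  rewrite -(card_imset _ injh); apply: eq_card => s.
  apply/imsetP/idP => [[u]|]; first by rewrite !inE => ? ->.
  by rewrite inE => ?; exists (h' s); rewrite ?inE h'K.
have swap : #|[set s : F | Tr s == 0]| = #|[set s : F | Tr s == 1]|.
  rewrite -(card_imset _ (addIr th)); apply: eq_card => s.
  apply/imsetP/idP => [[u]|]; rewrite !inE => /eqP tr.
    by move=> ->; rewrite trace2D tr trth add0r.
  by exists (s + th); rewrite ?inE ?trace2D ?tr ?trth ?two0 // -addrA (addxx two0) addr0.
have sub : [set s | Tr (g s) == 1] \subset [set s | Tr (f s) == 0].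
  apply/subsetP=> s; rewrite !inE => /eqP tg; case/orP: (trace2_01 (f s)) => // /eqP tf.
  by case: (dis s).
have /eqP eqs : [set s | Tr (g s) == 1] == [set s | Tr (f s) == 0].
  by rewrite eqEcard sub !half // swap /=.
move=> s; move/setP: eqs => /(_ s); rewrite !inE.
case/orP: (trace2_01 (f s)) => /eqP->; case/orP: (trace2_01 (g s)) => /eqP->;
  by rewrite ?eqxx ?oner_eq0 ?(eq_sym 0) ?oner_eq0 ?addr0 ?add0r.
Qed.

End Trace.

(** * Collisions of the cubic form on the affine line *)

Section Cubic.

Variables (n : nat) (F : finFieldType).
Hypotheses (n_gt0 : (0 < n)%N) (cardF : #|F| = (2 ^ n)%N).

Local Notation Tr := (@trace2 F n).
Let trD := trace2D cardF.
Let trS := trace2_sqr n_gt0 cardF.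
Let trAS := trace2_AS n_gt0 cardF.
Let tr01 := trace2_01 n_gt0 cardF.
Let tr0 := @trace2_0 n F cardF.

Let K : fieldType := F.
Add Field char2_field : (@char2_field_theory K)
  (morphism (char2_ring_morph (two0 cardF)), constants [f2_coef],
   power_tac (@char2_power_theory K) [f2_pow]).

Lemma add_eq0_char2 (x y : F) : (x + y == 0) = (x == y).
Proof. by rewrite -{1}(opp_char2 (two0 cardF) y) subr_eq0. Qed.

Lemma trace2_neq0 x : Tr x != 0 -> Tr x = 1.
Proof. by move=> nz; apply/eqP; have := tr01 x; rewrite (negPf nz). Qed.

Lemma noroot_trace2 (b : F) :
  (forall x, x ^+ 2 + x + b != 0) <-> Tr b = 1.
Proof.
split=> [nr|tr1 x].
  apply: trace2_neq0; apply/eqP=> /(hilbert90 n_gt0 cardF)[t et].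
  by have := nr t; rewrite et (addxx (two0 cardF)) eqxx.
apply/eqP=> /eqP; rewrite add_eq0_char2 => /eqP eb.
by have := trAS x; rewrite eb tr1 => /eqP; rewrite oner_eq0.
Qed.

(** Replacing [v^-1] by [v ^+ (q - 2)] turns the left side into a polynomial of degree below q that
    vanishes everywhere. Its coefficient of X is [mu]: for n > 2 no exponent [q - 1 - 2 ^ i] equals
    1. *)
Lemma inverse_sum_trace2 (mu nu : F) : (2 < n)%N ->
  (forall v, Tr (mu * v) + Tr (nu / v) = 0) -> mu = 0.
Proof.
move=> n2 sum0; have q8 : (4 < 2 ^ n)%N by rewrite (@ltn_exp2l 2 2).
have lt_half (i : 'I_n) : (2 ^ i < 2 ^ n - 2)%N.
  have : (2 ^ i <= 2 ^ n.-1)%N by rewrite leq_exp2l // -ltnS prednK.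
  have : (2 ^ n = 2 * 2 ^ n.-1)%N by rewrite -expnS prednK.
  by lia.
pose p : {poly F} := \sum_(i < n)
  (mu ^+ (2 ^ i) *: 'X^(2 ^ i) + nu ^+ (2 ^ i) *: 'X^((2 ^ n - 1) - 2 ^ i)).
have p0 : p = 0.
  apply: (poly_vanish cardF) => [|v].
    apply: leq_trans (size_sum _ _ _) _; apply/bigmax_leqP => i _.
    apply: leq_trans (size_polyD _ _) _; rewrite geq_max.
    rewrite !(leq_trans (size_scale_leq _ _)) // size_polyXn.
      by lia.
    by have := lt_half i; lia.
  rewrite -[RHS](sum0 v) horner_sum /trace2 -big_split; apply: eq_bigr => i _ /=.
  rewrite hornerD !hornerZ !hornerXn !exprMn; congr (_ + _ * _).
  have lt1 : (2 ^ i < 2 ^ n - 1)%N by have := lt_half i; lia.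
  (* At 0 both sides agree: the inverse of 0 is 0, and the exponent is positive. *)
  have [->|v0] := eqVneq v 0.
    by rewrite invr0 !expr0n -[(_ - _)%N == 0%N]negbK -lt0n subn_gt0 lt1 expn_eq0.
  apply: (mulIf (expf_neq0 (2 ^ i) v0)); rewrite -exprD subnK 1?ltnW //.
  rewrite -exprMn mulVf // expr1n; apply: (mulfI v0).
  by rewrite -exprS subn1 prednK ?expr_card ?mulr1 // (ltn_trans _ q8).
have : p`_1 = mu.
  rewrite coef_sum (bigD1 (Ordinal n_gt0)) //= big1 => [|i i0].
    rewrite coefD !coefZ !coefXn expr1 eqxx mulr1 addr0.
    have /negPf-> : 1%N != (2 ^ n - 1 - 1)%N by lia.
    by rewrite mulr0 addr0.
  rewrite coefD !coefZ !coefXn -[X in X == (2 ^ i)%N]/(2 ^ 0)%N eqn_exp2l //.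
  move: (i0); rewrite -val_eqE /= eq_sym => /negPf->.
  have /negPf-> : (2 ^ 0)%N != (2 ^ n - 1 - 2 ^ i)%N by have := lt_half i; lia.
  by rewrite !mulr0 addr0.
by rewrite p0 coef0.
Qed.

(** * Necessary conditions for injectivity *)

Section Collision.

Variables a1 a2 b : F.
Hypothesis trb : Tr b = 1.
Hypothesis inj : forall x y : F,
  (x ^+ 3 + a2 * x ^+ 2 + a1 * x) * (y ^+ 2 + y + b) =
  (y ^+ 3 + a2 * y ^+ 2 + a1 * y) * (x ^+ 2 + x + b) -> x = y.

Let b_neq0 : b != 0.
Proof. by apply: contra_eq_neq trb => ->; rewrite tr0 eq_sym oner_eq0. Qed.

(* [x] and [y = x + s] with product [p] collide iff this equation holds, and
   such [x], [y] exist iff [p / s ^+ 2] has trace 0. *)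
Lemma no_collision s p : s != 0 ->
  p ^+ 2 + p * (s + (b + a1 + a2)) + b * s ^+ 2 + a2 * b * s + a1 * b = 0 ->
  Tr (p / s ^+ 2) = 0 -> False.
Proof.
move=> s0 G /(hilbert90 n_gt0 cardF)[t et].
have ep : p = s ^+ 2 * (t ^+ 2 + t) by rewrite et; field_char2 K.
have /inj/eqP : ((s * t) ^+ 3 + a2 * (s * t) ^+ 2 + a1 * (s * t)) *
    ((s * t + s) ^+ 2 + (s * t + s) + b) =
    ((s * t + s) ^+ 3 + a2 * (s * t + s) ^+ 2 + a1 * (s * t + s)) *
    ((s * t) ^+ 2 + s * t + b).
  apply/eqP; rewrite -add_eq0_char2; apply/eqP.
  transitivity (s * (p ^+ 2 + p * (s + (b + a1 + a2)) + b * s ^+ 2 +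
    a2 * b * s + a1 * b)); last by rewrite G mulr0.
  by rewrite ep; ring_char2 K.
by rewrite -add_eq0_char2 addrA (addxx (two0 cardF)) add0r (negPf s0).
Qed.

(** Under the trace condition the collision equation has the two solutions [L * z] and [L * z + L]
    in F. Neither may give trace 0, so both give trace 1, and their difference [L] gives trace 0. *)
Lemma no_pair s : s != 0 -> s + (b + a1 + a2) != 0 ->
  Tr ((b * s ^+ 2 + a2 * b * s + a1 * b) / (s + (b + a1 + a2)) ^+ 2) = 0 ->
  Tr ((s + (b + a1 + a2)) / s ^+ 2) = 0.
Proof.
move=> s0; set L := s + _; have eL : L = s + (b + a1 + a2) by [].
clearbody L; move=> L0 /(hilbert90 n_gt0 cardF)[z ez].
have G : b * s ^+ 2 + a2 * b * s + a1 * b = L ^+ 2 * (z ^+ 2 + z).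
  by rewrite ez; field_char2 K.
apply/eqP/contraT => tr1; case: (@no_collision s (L * z)) => //.
  rewrite -eL; transitivity ((L * z) ^+ 2 + (L * z) * L +
    (b * s ^+ 2 + a2 * b * s + a1 * b)); first by ring_char2 K.
  by rewrite G; ring_char2 K.
apply/eqP/contraT => tr2; case: (@no_collision s (L * z + L)) => //.
  rewrite -eL; transitivity ((L * z + L) ^+ 2 + (L * z + L) * L +
    (b * s ^+ 2 + a2 * b * s + a1 * b)); first by ring_char2 K.
  by rewrite G; ring_char2 K.
by rewrite mulrDl trD (trace2_neq0 tr1) (trace2_neq0 tr2) (two0 cardF).
Qed.

(* With [r ^+ 2 = A], both solutions [p] of the collision equation for [s] are in
   F_q iff [Tr (C / (s + A)) = 1], and their values of [Tr (p / s ^+ 2)] differ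
   by [Tr (k / s)]. Complementarity determines [h v = Tr (k / A * v) + Tr (C / A / v)]
   (substitute [v = 1 + A / s]); for q > 4 its invariance under squaring forces
   [k = A], hence [A ^+ 2 + A + 1 = 0], against [Tr (k / A) = 1]. *)
Lemma cubic_A_eq1 : b + a1 + a2 = 1.
Proof.
have no_pairA := no_pair.
set A := b + a1 + a2 in no_pairA *; have eA : A = b + a1 + a2 by [].
clearbody A; apply/eqP/contraT => A1; exfalso.
have [r er] := sqrt_exists n_gt0 cardF A.
have [e ee] := sqrt_exists n_gt0 cardF (b * (A ^+ 2 + a2 * A + a1)).
have [k ek] : exists k, k = 1 + r by exists (1 + r).
have [C eC] : exists C, C = a2 * b + e by exists (a2 * b + e).
have k0 : k != 0.
  rewrite ek add_eq0_char2; apply: contraNneq A1 => r1.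
  by rewrite -er -r1 expr1n.
(* If [C = 0], then either [a2 = 1] and [A ^+ 2 = 1], or [b = t ^+ 2 + t] with
   [t = (A + 1) / (a2 + 1)], against [Tr b = 1]. *)
have C0 : C != 0.
  rewrite eC add_eq0_char2; apply/eqP => eC'.
  have eqb : b * (a2 + 1) ^+ 2 = A ^+ 2 + A * (a2 + 1) + a2.
    apply: (mulfI b_neq0); move: ee; rewrite -eC' => ee.
    transitivity ((a2 * b) ^+ 2 + b ^+ 2); first by ring_char2 K.
    rewrite ee eA; ring_char2 K.
  have [a21|a21] := eqVneq (a2 + 1) 0.
    move/eqP: (a21); rewrite add_eq0_char2 => /eqP ea2.
    move: eqb; rewrite a21 ea2 expr0n !mulr0 addr0 => /esym /eqP.
    rewrite add_eq0_char2 => /eqP eA'; case/eqP: A1.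
    apply/eqP; rewrite -add_eq0_char2 -sqrf_eq0; apply/eqP.
    transitivity (A ^+ 2 + 1); first by ring_char2 K.
    by rewrite eA' (two0 cardF).
  have eb : b = ((A + 1) / (a2 + 1)) ^+ 2 + (A + 1) / (a2 + 1).
    apply: (mulIf (expf_neq0 2 a21)); rewrite eqb; field_char2 K.
  by move: trb; rewrite eb trAS => /eqP; rewrite eq_sym oner_eq0.
have compl s : Tr (C / (s + A)) + Tr (k / s) = 1.
  apply: (@trace2_complementary n F n_gt0 cardF (fun s => C / (s + A)) (fun s => k / s))
    => [x y /(mulfI C0)|x y /(mulfI k0)|{}s trC trk].
  - by move/invr_inj/addIr.
  - exact: invr_inj.
  have s0 : s != 0.
    by apply: contra_eq_neq trk => ->; rewrite invr0 mulr0 tr0 eq_sym oner_eq0.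
  have L0 : s + A != 0.
    by apply: contra_eq_neq trC => ->; rewrite invr0 mulr0 tr0 eq_sym oner_eq0.
  have := no_pairA s s0 L0.
  (* Expansion in powers of [s + A]. The last term is the square of [e / (s + A)], so the trace of
     the whole is [Tr b + Tr (C / (s + A))]. *)
  have -> : (b * s ^+ 2 + a2 * b * s + a1 * b) / (s + A) ^+ 2 =
      b + a2 * b / (s + A) + b * (A ^+ 2 + a2 * A + a1) / (s + A) ^+ 2.
    by field_char2 K.
  rewrite -ee -expr_div_n !trD trS trb -addrA -trD -mulrDl -eC trC (two0 cardF).
  have -> : (s + A) / s ^+ 2 = s^-1 + (r / s) ^+ 2 by rewrite -er; field_char2 K.
  rewrite trD trS -trD; have -> : s^-1 + r / s = k / s by rewrite ek; field_char2 K.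
  by rewrite trk => /(_ erefl)/eqP; rewrite oner_eq0.
(* Here and in the next two facts, [compl] is evaluated where a denominator is 0; that summand is 0
   since the inverse of 0 is 0. *)
have A0 : A != 0.
  apply/eqP=> A0; move: (compl 0).
  by rewrite A0 addr0 invr0 !mulr0 tr0 addr0 => /esym/eqP; rewrite oner_eq0.
have trC : Tr (C / A) = 1.
  by move: (compl 0); rewrite add0r invr0 !mulr0 tr0 addr0.
have trk : Tr (k / A) = 1.
  by move: (compl A); rewrite (addxx (two0 cardF)) invr0 mulr0 tr0 add0r.
pose h v := Tr (k / A * v) + Tr (C / A / v).
have h0 : h 0 = 0 by rewrite /h invr0 !mulr0 tr0 addr0.
have h1 : h 1 = 0 by rewrite /h divr1 mulr1 trC trk (two0 cardF).
have hv v : v != 0 -> v != 1 -> h v = 1.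
  rewrite -[v == 1]add_eq0_char2 => v0 v1; have := compl (A / (v + 1)).
  have -> : C / (A / (v + 1) + A) = C / A + C / A / v.
    have -> : A / (v + 1) + A = A * v / (v + 1) by field_char2 K.
    by field_char2 K.
  have -> : k / (A / (v + 1)) = k / A * v + k / A by field_char2 K.
  rewrite !trD trC trk /h => <-; ring_char2 K.
have hS v : h (v ^+ 2) = h v.
  have [->|v0] := eqVneq v 0; first by rewrite expr0n.
  have [->|v1] := eqVneq v 1; first by rewrite expr1n.
  rewrite !hv // ?expf_neq0 // -[_ == 1]add_eq0_char2.
  have -> : v ^+ 2 + 1 = (v + 1) ^+ 2 by ring_char2 K.
  by rewrite expf_neq0 // add_eq0_char2.
(* The first equation makes [1 = A ^+ 2 + A] an element of trace 0, whereas [k = A] turns [trk] into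
   [Tr 1 = 1]. *)
have ord3 : A ^+ 2 + A + 1 = 0 -> k = A -> False.
  move=> eA' ekA; move: trk; rewrite ekA divff //.
  have -> : 1 = A ^+ 2 + A by apply/eqP; rewrite -add_eq0_char2 addrC eA'.
  rewrite trAS => /esym/eqP; have -> : A ^+ 2 + A = 1.
    by apply/eqP; rewrite -add_eq0_char2 eA'.
  by rewrite oner_eq0.
have ekk : k ^+ 2 = A + 1 by rewrite ek -er; ring_char2 K.
have [n_small|n_big] := leqP n 2; last first.
  (* With [v ^+ 2 = w], invariance of the trace under squaring rewrites [h (v ^+ 2) + h v = 0] as a
     relation in [w] and [1 / w]. *)
  have mu0 : (k / A) ^+ 2 + k / A = 0.
    apply: (inverse_sum_trace2 (nu := (C / A) ^+ 2 + C / A)) => [//|w].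
    have [v <-] := sqrt_exists n_gt0 cardF w.
    rewrite !mulrDl -expr_div_n -exprMn !trD !trS.
    transitivity (h (v ^+ 2) + h v); last by rewrite hS (addxx (two0 cardF)).
    by rewrite /h addrACA addrC.
  have ekA : k = A.
    apply/eqP; rewrite -(inj_eq (mulIf (invr_neq0 A0))) divff // -add_eq0_char2.
    rewrite -(mulrI_eq0 _ (mulfI (mulf_neq0 k0 (invr_neq0 A0)))).
    by rewrite mulrDr mulr1 -expr2 mu0.
  apply: ord3 => //; rewrite -addrA -ekk ekA; exact: (addxx (two0 cardF)).
(* For q at most 4, [A ^+ 4 = A], and the factors [A] and [A + 1] of [A ^+ 4 + A] are nonzero. *)
have eAA : A ^+ 2 + A + 1 = 0.
  apply: (mulfI A0); move: (A1); rewrite -add_eq0_char2 => A1'.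
  apply: (mulfI A1'); rewrite !mulr0.
  transitivity (A ^+ 4 + A); first by ring_char2 K.
  have := expr_card cardF A; case: n n_gt0 n_small => [|[|[|]]] //= _ _.
    rewrite expn1 => e2; rewrite -[4%N]/(2 * 2)%N exprM !e2; exact: (addxx (two0 cardF)).
  by move=> ->; exact: (addxx (two0 cardF)).
apply: ord3 => //; apply/eqP; rewrite -add_eq0_char2 -sqrf_eq0; apply/eqP.
transitivity (k ^+ 2 + A ^+ 2); first by ring_char2 K.
by rewrite ekk -eAA; ring_char2 K.
Qed.
(* Since [A = 1], the function is [X + (a2 + 1) + beta / D]; so [x] and [x + s]
   collide iff [d = D(x)] solves the equation of [no_shift], and [D] takes
   exactly the values of trace 1. *)
Lemma cubic_beta_eq1 : b * (a2 + 1) != 0 -> b * (a2 + 1) = 1.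
Proof.
have ea1 : a1 = b + a2 + 1 by rewrite -cubic_A_eq1; ring_char2 K.
set beta := b * (a2 + 1); have ebeta : beta = b * (a2 + 1) by [].
clearbody beta => beta0.
have no_shift s d : s != 0 -> Tr d = 1 ->
    d ^+ 2 + d * (s ^+ 2 + s) + beta * (s + 1) = 0 -> False.
  move=> s0 trd eqd.
  have [|t et] := @hilbert90 n F n_gt0 cardF (d + b) => //.
    by rewrite trD trd trb (two0 cardF).
  have ed : d = t ^+ 2 + t + b by rewrite et; ring_char2 K.
  have /inj/eqP : (t ^+ 3 + a2 * t ^+ 2 + a1 * t) * ((t + s) ^+ 2 + (t + s) + b) =
      ((t + s) ^+ 3 + a2 * (t + s) ^+ 2 + a1 * (t + s)) * (t ^+ 2 + t + b).
    apply/eqP; rewrite -add_eq0_char2; apply/eqP.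
    transitivity (s * (d ^+ 2 + d * (s ^+ 2 + s) + beta * (s + 1))).
      by rewrite ed ebeta ea1; ring_char2 K.
    by rewrite eqd mulr0.
  by rewrite -add_eq0_char2 addrA (addxx (two0 cardF)) add0r (negPf s0).
have [g eg] := sqrt_exists n_gt0 cardF beta.
have g0 : g != 0 by apply: contraNneq beta0 => g0; rewrite -eg g0 expr0n.
rewrite -eg; suff -> : g = 1 by rewrite expr1n.
apply/eqP/contraT => g1; exfalso.
have g1' : g + 1 != 0 by rewrite add_eq0_char2.
(* The pair [s = g + 1], [d = g] solves the equation of [no_shift]. *)
have trg : Tr g = 0.
  apply/eqP/contraT => /trace2_neq0 trg; case: (no_shift (g + 1) g) => //.
  by rewrite -eg; ring_char2 K.
(* Chosen so that, for [d = x + beta], the trace of [d * (d ^+ 2 + beta) / x ^+ 2] is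
   [Tr d + Tr (C / x)]. *)
pose C := g ^+ 3 * (g + 1).
have C0 : C != 0 by rewrite mulf_neq0 ?expf_neq0.
suff dis x : Tr (C / x) = 1 -> Tr x = 1 -> False.
  have injC : injective (fun e => C / e) by move=> u v /(mulfI C0)/invr_inj.
  have := trace2_complementary n_gt0 cardF injC (@inj_id F) dis 0.
  by rewrite invr0 mulr0 tr0 addr0 => /esym/eqP; rewrite oner_eq0.
move=> trC trx.
have x0 : x != 0.
  by apply: contra_eq_neq trx => ->; rewrite tr0 eq_sym oner_eq0.
have [d edx] : exists d, d = x + beta by exists (x + beta).
have trd : Tr d = 1 by rewrite edx trD trx -eg trS trg addr0.
have d0 : d != 0 by apply: contra_eq_neq trd => ->; rewrite tr0 eq_sym oner_eq0.
(* As a quadratic in [s], the equation of [no_shift] is [d * s ^+ 2 + x * s + d ^+ 2 + beta = 0];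
   the substitution [s = z * x / d] brings it to Artin-Schreier form. *)
have [|z ez] := @hilbert90 n F n_gt0 cardF (d * (d ^+ 2 + beta) / x ^+ 2) => //.
  have -> : d * (d ^+ 2 + beta) / x ^+ 2 =
      d + ((g ^+ 2 + g ^+ 4) / x + (g ^+ 2 * (g + 1) / x) ^+ 2).
    by rewrite edx -eg; field_char2 K.
  rewrite trD trd trD trS -trD.
  have -> : (g ^+ 2 + g ^+ 4) / x + g ^+ 2 * (g + 1) / x = C / x.
    by rewrite /C; field_char2 K.
  by rewrite trC (two0 cardF).
case: (no_shift (z * x / d) d) => //.
  (* [z = 0] would force [d ^+ 2 = beta], so [d = g], but their traces differ. *)
  rewrite !mulf_neq0 ?invr_neq0 //; apply/eqP => z0; move/eqP: ez.
  rewrite z0 expr0n addr0 eq_sym !mulf_eq0 (negPf d0) invr_eq0 expf_eq0 /= (negPf x0).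
  rewrite orbF -eg; have -> : d ^+ 2 + g ^+ 2 = (d + g) ^+ 2 by ring_char2 K.
  rewrite sqrf_eq0 add_eq0_char2 => /eqP edg.
  by move: trd; rewrite edg trg => /eqP; rewrite eq_sym oner_eq0.
have eb : beta = x + d by rewrite edx; ring_char2 K.
transitivity (x ^+ 2 / d * ((z ^+ 2 + z) + d * (d ^+ 2 + beta) / x ^+ 2)).
  by rewrite eb; field_char2 K.
by rewrite ez (addxx (two0 cardF)) mulr0.
Qed.

End Collision.

(* If [x] and [y = x + s] collide, then [x + s * (s + 1) / (d + s ^+ 2 + 1)] with
   [d = x ^+ 2 + x + b] is a root of [X ^+ 2 + X + b]. *)
Lemma cubic_form_inj (b x y : F) : Tr b = 1 ->
  (x ^+ 3 + (1 + 1 / b) * x ^+ 2 + (b + 1 / b) * x) * (y ^+ 2 + y + b) =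
  (y ^+ 3 + (1 + 1 / b) * y ^+ 2 + (b + 1 / b) * y) * (x ^+ 2 + x + b) -> x = y.
Proof.
move=> trb; have b0 : b != 0.
  by apply: contra_eq_neq trb => ->; rewrite tr0 eq_sym oner_eq0.
have nr := (noroot_trace2 b).2 trb.
have [s ->] : exists s, y = x + s by exists (y - x); rewrite addrC subrK.
have [d ed] : exists d, d = x ^+ 2 + x + b by exists (x ^+ 2 + x + b).
have d0 : d != 0 by rewrite ed.
move/eqP; rewrite -add_eq0_char2 => /eqP collide.
apply/eqP; rewrite -add_eq0_char2 addrA (addxx (two0 cardF)) add0r.
apply/contraT=> s0.
have eqd : d ^+ 2 + d * (s ^+ 2 + s) + s + 1 = 0.
  apply: (mulfI s0); rewrite mulr0 -collide ed; field_char2 K.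
(* If this denominator vanished, [eqd] would give [s = 1] and then [d = 0]. *)
have w0 : d + s ^+ 2 + 1 != 0.
  apply/eqP=> w0; have ed' : d = s ^+ 2 + 1.
    by apply/eqP; rewrite -add_eq0_char2 addrA w0.
  have : s ^+ 2 * (s + 1) = 0 by rewrite -eqd ed'; ring_char2 K.
  move/eqP; rewrite mulf_eq0 expf_eq0 /= (negPf s0) /= => /eqP s1.
  move/eqP: d0; apply; rewrite ed'; transitivity ((s + 1) ^+ 2); first by ring_char2 K.
  by rewrite s1 expr0n.
have := nr (x + s * (s + 1) / (d + s ^+ 2 + 1)); case/eqP.
transitivity ((d + s ^+ 2 + s) * (d ^+ 2 + d * (s ^+ 2 + s) + s + 1) / (d + s ^+ 2 + 1) ^+ 2).
  transitivity (d + (s * (s + 1) / (d + s ^+ 2 + 1)) ^+ 2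
    + s * (s + 1) / (d + s ^+ 2 + 1)); first by rewrite ed; ring_char2 K.
  by clear ed; field_char2 K.
by rewrite eqd mulr0 mul0r.
Qed.

End Cubic.

(** * Identities and Moebius computations over a general field *)

Section CharTwoIdentities.

Variable K : fieldType.
Hypothesis two0K : (1 + 1 : K) = 0.
Add Field char2_field_K : (@char2_field_theory K)
  (morphism (char2_ring_morph two0K), constants [f2_coef],
   power_tac (@char2_power_theory K) [f2_pow]).

(** Here [g = c + y] with [y = e / (a * x)]. The coefficients are those of a cubic p with [p(c + y)
    + p(c) = a * y ^+ 3 + a * y ^+ 2 + e * y]. *)
Lemma cubic_polynomial_at_infinity (a c e x : K) :
  a != 0 -> e != 0 -> x != 0 ->
  let g := (c * (a / e) * x + 1) / (a / e * x + 0) in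
  ((e + a * c ^+ 2) * c + a * (c + 1) * c ^+ 2 + a * c ^+ 3
    + (e + a * c ^+ 2) * g + a * (c + 1) * g ^+ 2 + a * g ^+ 3) * x ^+ 3
  = e ^+ 2 / a * (x ^+ 2 + x + e / a).
Proof.
move=> a0 e0 x0 /=; rewrite addr0; field_char2 K.
Qed.

(** Division of the numerator by the denominator leaves remainder 1, which is a Bezout relation for
    the two. *)
Lemma cubic_form_division (b x : K) : b != 0 ->
  x ^+ 3 + (1 + 1 / b) * x ^+ 2 + (b + 1 / b) * x
    + (x ^+ 2 + x + b) * (x + 1 / b) = 1.
Proof.
by move=> b0; field_char2 K.
Qed.

(** A linear map multiplies the cross product of two vectors by its determinant. *)
Lemma cross_det (a b c d u v u' v' : K) : a * d - b * c != 0 ->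
  (a * u + b * v) * (c * u' + d * v') = (a * u' + b * v') * (c * u + d * v) ->
  u * v' = u' * v.
Proof.
move=> det e; apply: (mulfI det); apply/eqP; rewrite -subr_eq0; apply/eqP.
transitivity ((a * u + b * v) * (c * u' + d * v')
  - (a * u' + b * v') * (c * u + d * v)); last by rewrite e subrr.
by ring_char2 K.
Qed.

Lemma det_mul_neq0 (a b c d a' b' c' d' : K) :
  a * d - b * c != 0 -> a' * d' - b' * c' != 0 ->
  (a * a' + b * c') * (c * b' + d * d') - (a * b' + b * d') * (c * a' + d * c') != 0.
Proof.
move=> det det'; suff -> : (a * a' + b * c') * (c * b' + d * d')
    - (a * b' + b * d') * (c * a' + d * c') = (a * d - b * c) * (a' * d' - b' * c').
  exact: mulf_neq0.
by ring_char2 K.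
Qed.

End CharTwoIdentities.

Lemma moebius_inverse (K : fieldType) (a b c d x g : K) :
  a * d - b * c != 0 -> c * x + d != 0 -> g * (c * x + d) = a * x + b ->
  a - c * g != 0 /\ x = (d * g - b) / (a - c * g).
Proof.
move=> det D0 gE.
have eD : (a - c * g) * (c * x + d) = a * d - b * c.
  rewrite mulrBl -mulrA gE !mulrDr opprD addrACA mulrCA subrr add0r.
  by rewrite [c * b]mulrC.
have den0 : a - c * g != 0.
  by apply: contraNneq det => e0; rewrite -eD e0 mul0r.
split=> //; apply: (mulIf den0); rewrite divfK //.
have -> : b = g * (c * x + d) - a * x by rewrite gE addrC addKr.
rewrite opprB !mulrDr opprD [d * g]mulrC addrCA [g * d + _]addrC subrK.
by rewrite mulrN [x * a]mulrC [x * (c * g)]mulrCA [g * (c * x)]mulrCA [g * x]mulrC.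
Qed.

Lemma algebraic_moebius (F K : fieldType) (phi : {rmorphism F -> K}) a b c d g :
  algebraicOver phi g ->
  algebraicOver phi ((phi d * g - phi b) / (phi a - phi c * g)).
Proof.
move=> alg_g; have algC u : algebraicOver phi (phi u) by exact: algebraic_id.
by apply: algebraic_div; apply: algebraic_sub => //; exact: algebraic_mul.
Qed.

Lemma scaled_cubic_form (F K : fieldType) (phi : {rmorphism F -> K}) (x : K)
    (p0 p1 p2 p3 q0 q1 q2 q3 u a1 a2 b : F) :
  let g := (phi u * x + phi 0) / (phi 0 * x + phi 1) in
  p0 = 0 -> p1 * u = a1 -> p2 * u ^+ 2 = a2 -> p3 * u ^+ 3 = 1 ->
  q0 = b -> q1 * u = 1 -> q2 * u ^+ 2 = 1 -> q3 = 0 ->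
  (phi p0 + phi p1 * g + phi p2 * g ^+ 2 + phi p3 * g ^+ 3) /
  (phi q0 + phi q1 * g + phi q2 * g ^+ 2 + phi q3 * g ^+ 3) =
  (x ^+ 3 + phi a2 * x ^+ 2 + phi a1 * x) / (x ^+ 2 + x + phi b).
Proof.
rewrite /= rmorph0 rmorph1 mul0r addr0 add0r divr1 => -> <- <- p3u -> q1u q2u ->.
have scale p k : phi p * (phi u * x) ^+ k = phi (p * u ^+ k) * x ^+ k.
  by rewrite exprMn mulrA rmorphM rmorphXn.
have scale1 p : phi p * (phi u * x) = phi (p * u) * x := scale p 1.
rewrite !rmorph0 mul0r addr0 add0r !scale !scale1 p3u q1u q2u rmorph1 !mul1r.
by congr (_ / _); rewrite addrC [X in _ + X]addrC addrA.
Qed.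

Lemma moebius_frac (K : fieldType) (a b c d u v : K) : v != 0 ->
  (a * (u / v) + b) / (c * (u / v) + d) = (a * u + b * v) / (c * u + d * v).
Proof.
move=> v0; rewrite -{1}[b](mulfK v0) -{1}[d](mulfK v0) !mulrA -!mulrDl.
by rewrite -mulf_div divff ?mulr1 // invr_neq0.
Qed.

Lemma cross_divE (K : fieldType) (k den z y : K) :
  k != 0 -> z != 0 -> den * z = k * y -> k / den = z / y.
Proof.
move=> k0 z0 e; have [y0|y0] := eqVneq y 0.
  move: e; rewrite y0 mulr0 => /eqP; rewrite mulf_eq0 (negPf z0) orbF => /eqP ->.
  by rewrite invr0 !mulr0.
have den0 : den != 0.
  by apply: contra_neq (mulf_neq0 k0 y0) => den0; rewrite -e den0 mul0r.
by apply/eqP; rewrite eqr_div // -e mulrC.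
Qed.

Lemma cubic_polynomial_form (F K : fieldType) (phi : {rmorphism F -> K}) (x : K)
    (a c e : F) : (1 + 1 : K) = 0 -> a != 0 -> e != 0 -> x != 0 ->
  let g := (phi (c * (a / e)) * x + phi 1) / (phi (a / e) * x + phi 0) in
  phi (e ^+ 2 / a) /
  (phi ((e + a * c ^+ 2) * c + a * (c + 1) * c ^+ 2 + a * c ^+ 3)
    + phi (e + a * c ^+ 2) * g + phi (a * (c + 1)) * g ^+ 2 + phi a * g ^+ 3) =
  (x ^+ 3 + phi 0 * x ^+ 2 + phi 0 * x) / (x ^+ 2 + x + phi (e / a)).
Proof.
move=> two0K a0 e0 x0 g.
have := @cubic_polynomial_at_infinity K two0K (phi a) (phi c) (phi e) x.
rewrite !fmorph_eq0 => /(_ a0 e0 x0).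
rewrite -[1 in X in X -> _](rmorph1 phi) -[0 in X in X -> _](rmorph0 phi).
rewrite -!(fmorph_div phi) -!(rmorphXn phi) -?(fmorph_div phi) -!(rmorphM phi).
rewrite -?(rmorphD phi) -?(rmorphM phi) -?(rmorphD phi) -/g => E.
rewrite rmorph0 !mul0r !addr0; apply: cross_divE E; last exact: expf_neq0.
by rewrite fmorph_eq0 mulf_neq0 ?expf_neq0 ?invr_neq0.
Qed.

(** * Lowest terms, evaluation on the projective line, and composition *)

Section RatFun.

Variable F : fieldType.
Implicit Types (p q : {poly F}) (f g : ratfun F).

Notation iota := (@FracField.tofrac {poly F} \o polyC).
Notation ev p g := (map_poly iota p).[g].
Notation x := ('X%:F : ratfun F).

(** By Gauss's lemma the two denominators divide each other, so they differ by a scalar. *)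
Lemma rnum_rden_coprime f p q : coprimep p q -> q != 0 -> f = p%:F / q%:F ->
  exists2 k, k != 0 & rnum f = k *: p /\ rden f = k *: q.
Proof.
move=> cpq q0 fE; have := ratfun_numdenE f; rewrite {1}fE => /eqP.
rewrite eqr_div ?tofrac_eq0 ?rden_neq0 // -!tofracM tofrac_eq => /eqP e.
have qd : q %| rden f.
  by rewrite -(Gauss_dvdpr _ (_ : coprimep q p)) 1?coprimep_sym // e dvdp_mull.
have dq : rden f %| q.
  rewrite -(Gauss_dvdpr _ (_ : coprimep (rden f) (rnum f))) -?e ?dvdp_mull //.
  by rewrite coprimep_sym coprimep_rnum_rden.
have /eqpP[[c d] /= /andP[c0 d0] ecd] : rden f %= q by rewrite /eqp dq qd.
have er : rden f = (d / c) *: q.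
  by apply: (scalerI c0); rewrite ecd scalerA mulrC divfK.
exists (d / c); first by rewrite mulf_neq0 ?invr_neq0.
split=> //; apply: (mulIf q0); rewrite -e er -scalerAl -scalerAr; done.
Qed.

Lemma rdeg_coprime f p q : coprimep p q -> q != 0 -> f = p%:F / q%:F ->
  rdeg f = maxn (size p).-1 (size q).-1.
Proof.
move=> cpq q0 /(rnum_rden_coprime cpq q0)[k k0 [en ed]].
by rewrite /rdeg en ed !size_scale.
Qed.

Lemma rcomp_coprime f g p q : coprimep p q -> q != 0 -> f = p%:F / q%:F ->
  rcomp f g = ev p g / ev q g.
Proof.
move=> cpq q0 /(rnum_rden_coprime cpq q0)[k k0 [en ed]].
rewrite /rcomp en ed !map_polyZ !hornerZ -mulf_div divff ?mul1r //.
by rewrite /= tofrac_eq0 polyC_eq0.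
Qed.

(** The point [u : v]; the pair (0, 0) also goes to infinity, so it has to be excluded when points
    are compared. *)
Definition ratio (u v : F) : proj_line F := if v == 0 then None else Some (u / v).

Lemma ratio_eq u v u' v' : (u != 0) || (v != 0) -> (u' != 0) || (v' != 0) ->
  (u * v' = u' * v <-> ratio u v = ratio u' v').
Proof.
rewrite /ratio; have [->|v0] := eqVneq v 0; have [->|v'0] := eqVneq v' 0;
  rewrite /= ?orbT ?orbF => nz nz' //.
- by rewrite !mulr0.
- split=> // /eqP; rewrite mulr0 mulf_eq0 (negPf nz) (negPf v'0); done.
- split=> // /esym/eqP; rewrite mulr0 mulf_eq0 (negPf nz') (negPf v0); done.
- split=> [e|[] /eqP]; last by rewrite eqr_div // => /eqP.
  by congr Some; apply/eqP; rewrite eqr_div //; apply/eqP.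
Qed.

Lemma reval_coprime f p q (y : proj_line F) :
  coprimep p q -> q != 0 -> f = p%:F / q%:F ->
  reval f y = let m := maxn (size p).-1 (size q).-1 in
    if y is Some a then ratio p.[a] q.[a] else ratio p`_m q`_m.
Proof.
move=> cpq q0 fE; rewrite /reval (rdeg_coprime cpq q0 fE) /=.
have [k k0 [-> ->]] := rnum_rden_coprime cpq q0 fE.
have ratioZ u v : (if k * v == 0 then None else Some (k * u / (k * v))) = ratio u v.
  by rewrite /ratio mulf_eq0 (negPf k0) /= -mulf_div divff // mul1r.
by case: y => [a|]; rewrite ?hornerZ ?coefZ ratioZ.
Qed.

(** Points coincide iff their cross product vanishes. Coprimality excludes (0, 0) at finite points,
    and at infinity one of the coefficients of index [m] is a leading one. *)
Lemma reval_inj_cross f p q : coprimep p q -> q != 0 -> f = p%:F / q%:F ->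
  let m := maxn (size p).-1 (size q).-1 in
  injective (reval f) <->
  (forall a b, p.[a] * q.[b] = p.[b] * q.[a] -> a = b) /\
  (forall a, p.[a] * q`_m <> p`_m * q.[a]).
Proof.
move=> cpq q0 fE m; have rE y := reval_coprime y cpq q0 fE.
have nz a : (p.[a] != 0) || (q.[a] != 0).
  rewrite orbC -implybE; apply/implyP => /eqP/rootP qa.
  by rewrite coprimep_sym in cpq; exact: coprimep_root cpq qa.
have nzm : (p`_m != 0) || (q`_m != 0).
  rewrite /m; case: leqP => [le|lt].
    by rewrite -/(lead_coef q) lead_coef_eq0 q0 orbT.
  rewrite -/(lead_coef p) lead_coef_eq0.
  by case: eqVneq lt => // ->; rewrite size_poly0.
split=> [inj|[I1 I2] [a|] [b|] //].
  split=> [a b cross|a cross].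
    suff [] : Some a = Some b by [].
    by apply: inj; rewrite !rE /=; apply/ratio_eq.
  suff : Some a = None by [].
  by apply: inj; rewrite !rE /=; apply/ratio_eq.
- by rewrite !rE /= => /ratio_eq/I1-> //.
- by rewrite !rE /= => /ratio_eq e; case: (I2 a); apply: e.
- by rewrite !rE /= => /esym/ratio_eq e; case: (I2 b); apply: e.
Qed.

Lemma evC_alg p : ev p x = p%:F.
Proof.
rewrite map_poly_comp horner_map /=; congr (_ %:F).
by have := comp_polyXr p; rewrite /comp_poly.
Qed.

(** A root [m] of [p] would be algebraic over F, and so would X, the image of [m] under the inverse
    Moebius map; but X is transcendental. *)
Lemma ev_moebius_neq0 (m : ratfun F) p : is_moebius m -> p != 0 -> ev p m != 0.
Proof.
move=> [a [b [c [d [det ->]]]]] p0; set g := _ / _; apply/eqP=> evg.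
have alg_g : algebraicOver iota g by exists p => //; apply/rootP.
have D0 : (c *: 'X + d%:P)%:F != 0 :> ratfun F.
  rewrite tofrac_eq0; apply: contraNneq det => /polyP e.
  have := e 0%N; have := e 1%N; rewrite !coefD !coefZ !coefX !coefC /=.
  by rewrite ?coef0 !(mulr1, mulr0, add0r, addr0) => -> ->; rewrite !mulr0 subrr.
have linE u v : (u *: 'X + v%:P)%:F = iota u * x + iota v.
  by rewrite tofracD -mul_polyC tofracM.
have det' : iota a * iota d - iota b * iota c != 0.
  by rewrite -!rmorphM -rmorphB fmorph_eq0.
rewrite linE in D0.
have gE : g * (iota c * x + iota d) = iota a * x + iota b.
  by rewrite -(linE a b) /g (linE c d) divfK.
have [den0 xE] := moebius_inverse det' D0 gE.
have [q q0] := algebraic_moebius a b c d alg_g; rewrite -xE.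
move=>  /rootP; rewrite evC_alg => /eqP; rewrite tofrac_eq0 (negPf q0); done.
Qed.

Lemma linE (u v : F) : (u *: 'X + v%:P)%:F = iota u * x + iota v.
Proof. by rewrite tofracD -mul_polyC tofracM. Qed.

Lemma tofrac_cubic (a1 a2 : F) : ('X^3 + a2 *: 'X^2 + a1 *: 'X)%:F =
  x ^+ 3 + iota a2 * x ^+ 2 + iota a1 * x.
Proof.
have scaleE c k : (c *: 'X^k)%:F = iota c * x ^+ k.
  by rewrite -mul_polyC tofracM tofracXn.
by rewrite !tofracD tofracXn (scaleE a2 2) (scaleE a1 1).
Qed.

Lemma tofrac_quadratic (b : F) : ('X^2 + 'X + b%:P)%:F = x ^+ 2 + x + iota b.
Proof. by rewrite !tofracD tofracXn. Qed.

Lemma cubic_formE (a1 a2 b : F) : cubic_form a1 a2 b =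
  (x ^+ 3 + iota a2 * x ^+ 2 + iota a1 * x) / (x ^+ 2 + x + iota b).
Proof. by rewrite /cubic_form tofrac_cubic tofrac_quadratic. Qed.

Lemma horner4 (R : nzRingType) (p : {poly R}) a : (size p <= 4)%N ->
  p.[a] = p`_0 + p`_1 * a + p`_2 * a ^+ 2 + p`_3 * a ^+ 3.
Proof.
move=> sz; rewrite (horner_coef_wide _ sz) !big_ord_recr big_ord0 /=.
by rewrite add0r expr0 mulr1 expr1.
Qed.

Lemma ev4 p g : (size p <= 4)%N ->
  ev p g = iota p`_0 + iota p`_1 * g + iota p`_2 * g ^+ 2 + iota p`_3 * g ^+ 3.
Proof. by move=> sz; rewrite horner4 ?size_map_poly // !coef_map. Qed.

Lemma ev_lin a b g : ev (a *: 'X + b%:P) g = iota a * g + iota b.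
Proof. by rewrite rmorphD /= map_polyZ map_polyX map_polyC hornerD hornerZ hornerX hornerC. Qed.

(* The pairs representing [m \o f], for [m] a Moebius transformation. *)
Definition pencil f p q := exists a b c d : F, [/\ a * d - b * c != 0,
  p = a *: rnum f + b *: rden f & q = c *: rnum f + d *: rden f].

Lemma pencil_refl f : pencil f (rnum f) (rden f).
Proof.
exists 1, 0, 0, 1; rewrite mulr1 mulr0 subr0 oner_neq0.
by rewrite !scale1r !scale0r addr0 add0r.
Qed.

Lemma pencil_comb f p q (a b c d : F) : (1 + 1 : F) = 0 -> a * d - b * c != 0 -> pencil f p q ->
  pencil f (a *: p + b *: q) (c *: p + d *: q).
Proof.
move=> two0F det [a' [b' [c' [d' [det' -> ->]]]]].
exists (a * a' + b * c'), (a * b' + b * d'), (c * a' + d * c'), (c * b' + d * d').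
split; last 2 first.
- by rewrite !scalerDr !scalerDl !scalerA addrACA.
- by rewrite !scalerDr !scalerDl !scalerA addrACA.
exact: det_mul_neq0.
Qed.

Lemma coprimep_linear (a b c d : F) : a * d - b * c != 0 ->
  coprimep (a *: 'X + b%:P) (c *: 'X + d%:P) /\ c *: 'X + d%:P != 0.
Proof.
move=> det; split.
  apply/Bezout_coprimepP; exists ((- c)%:P, a%:P) => /=.
  rewrite !mul_polyC !scalerDr !scalerA -!mul_polyC -!polyCM.
  rewrite addrACA -mulrDl -polyCD mulNr [a * c]mulrC addNr mul0r add0r -polyCD.
  by rewrite -size_poly_eq1 size_polyC addrC mulNr [c * b]mulrC det.
apply: contraNneq det => /polyP e.
have := e 0%N; have := e 1%N; rewrite !coefD !coefZ !coefX !coefC /=.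
by rewrite ?coef0 !(mulr1, mulr0, add0r, addr0) => -> ->; rewrite !mulr0 subrr.
Qed.

Lemma ratfun_equiv_pencil f p q m : pencil f p q -> is_moebius m ->
  ratfun_equiv f (ev p m / ev q m).
Proof.
move=> [a [b [c [d [det -> ->]]]]] mm.
exists ((a *: 'X + b%:P)%:F / (c *: 'X + d%:P)%:F), m; split=> //.
  by exists a, b, c, d.
have [cop nz] := coprimep_linear det.
rewrite (rcomp_coprime _ cop nz erefl) !ev_lin /rcomp.
have D0 := ev_moebius_neq0 mm (rden_neq0 f).
rewrite !rmorphD /= !map_polyZ !hornerD !hornerZ.
exact: moebius_frac.
Qed.

End RatFun.

(** * Normal form of cubic permutation functions *)

Section CubicRatFun.

Variables (n : nat) (F : finFieldType).
Hypotheses (n_gt0 : (0 < n)%N) (cardF : #|F| = (2 ^ n)%N).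

Let two0F := two0 cardF.
Let K : fieldType := F.
Add Field char2_field_F : (@char2_field_theory K)
  (morphism (char2_ring_morph two0F), constants [f2_coef],
   power_tac (@char2_power_theory K) [f2_pow]).

Lemma two0_ratfun : 1 + 1 = 0 :> ratfun F.
Proof. by rewrite -tofrac1 -tofracD -polyC1 -polyCD two0F polyC0 tofrac0. Qed.

Lemma pencil_cross (f : ratfun F) (p q : {poly F}) :
  rdeg f = 3%N -> injective (reval f) -> pencil f p q ->
  [/\ (size p <= 4)%N, (size q <= 4)%N,
      forall a b, p.[a] * q.[b] = p.[b] * q.[a] -> a = b
    & forall a, p.[a] * q`_3 <> p`_3 * q.[a]].
Proof.
move=> deg3 inj [a [b [c [d [det -> ->]]]]].
have [szN szD] : (size (rnum f) <= 4)%N /\ (size (rden f) <= 4)%N.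
  by move: deg3; rewrite /rdeg; lia.
have := (reval_inj_cross (coprimep_rnum_rden f) (rden_neq0 f) (ratfun_numdenE f)).1 inj.
rewrite -/(rdeg f) deg3 => -[I1 I2].
split.
- by rewrite (leq_trans (size_polyD _ _)) // geq_max !(leq_trans (size_scale_leq _ _)).
- by rewrite (leq_trans (size_polyD _ _)) // geq_max !(leq_trans (size_scale_leq _ _)).
- move=> y z; rewrite !hornerD !hornerZ => e; apply: I1.
  exact: cross_det two0F _ _ _ _ _ _ _ _ det e.
- move=> y; rewrite !hornerD !hornerZ !coefD !coefZ => e; apply: (I2 y).
  exact: cross_det two0F _ _ _ _ _ _ _ _ det e.
Qed.

Lemma cubic_permutation_equiv (f : ratfun F) :
  rdeg f = 3%N -> permutation_ratfun f ->
  exists a1 a2 b : F, trace2 n b = 1 /\ ratfun_equiv f (cubic_form a1 a2 b).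
Proof.
move=> deg3 /bij_inj inj.
(* A Moebius map on the left moves the image of infinity back to infinity. *)
have [p [q [pen q3]]] : exists p q, pencil f p q /\ q`_3 = 0.
  have [N3|N3] := eqVneq (rnum f)`_3 0.
    exists (0 *: rnum f + 1 *: rden f), (1 *: rnum f + 0 *: rden f); split.
      apply: (pencil_comb two0F) (pencil_refl f).
      by rewrite mul0r mulr1 sub0r oppr_eq0 oner_neq0.
    by rewrite coefD !coefZ N3 mulr0 mul0r addr0.
  exists (1 *: rnum f + 0 *: rden f),
    (- (rden f)`_3 *: rnum f + (rnum f)`_3 *: rden f); split.
    by apply: (pencil_comb two0F) (pencil_refl f); rewrite mul1r mul0r subr0.
  by rewrite coefD !coefZ mulNr mulrC addNr.
have [sp sq I1 I2] := pencil_cross deg3 inj pen.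
have q_neq0 a : q.[a] != 0.
  by apply/eqP=> qa; apply: (I2 a); rewrite qa q3 !mulr0.
have p3 : p`_3 != 0.
  by apply/eqP=> p3; apply: (I2 0); rewrite p3 q3 mul0r mulr0.
have pE a : p.[a] = p`_0 + p`_1 * a + p`_2 * a ^+ 2 + p`_3 * a ^+ 3 by exact: horner4.
have qE a : q.[a] = q`_0 + q`_1 * a + q`_2 * a ^+ 2.
  by rewrite horner4 // q3 mul0r addr0.
have q0 : q`_0 != 0.
  by have := q_neq0 0; rewrite qE expr0n !mulr0 !addr0.
have [q2|q2] := eqVneq q`_2 0.
  have q1 : q`_1 = 0.
    apply/eqP/contraT => q1; have := q_neq0 (q`_0 / q`_1); rewrite qE q2.
    by case/eqP; field_char2 K.
  have qc : q = (q`_0)%:P.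
    apply/polyP=> -[|[|[|[|i]]]]; rewrite coefC //=.
    by rewrite nth_default // (leq_trans sq).
  (* Polynomial case: [c] and [e] are chosen so that [p(c + y) + p(c) = a * y ^+ 3 + a * y ^+ 2 + e
     * y]. *)
  have [a ea] : exists a, a = p`_3 by exists p`_3.
  have [c ec] : exists c, c = p`_2 / p`_3 + 1 by exists (p`_2 / p`_3 + 1).
  have [e ee] : exists e, e = p`_1 + p`_3 * c ^+ 2 by exists (p`_1 + p`_3 * c ^+ 2).
  have p1E : p`_1 = e + a * c ^+ 2 by rewrite ee ea; ring_char2 K.
  have p2E : p`_2 = a * (c + 1) by rewrite ec ea; field_char2 K.
  have a0 : a != 0 by rewrite ea.
  have shift y : p.[c + y] = p.[c] -> y = 0.
    move=> e'; apply: (addrI c); rewrite addr0; apply: I1.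
    by rewrite e' !qE q1 q2 !mul0r !addr0.
  have e0 : e != 0.
    apply/eqP=> e0; have /shift/eqP : p.[c + 1] = p.[c]; last by rewrite oner_eq0.
    by rewrite !pE p1E p2E -ea e0; ring_char2 K.
  exists 0, 0, (e / a); split.
    apply/(noroot_trace2 n_gt0 cardF) => r; apply/eqP=> root_r.
    have r0 : r != 0.
      apply: contraNneq (mulf_neq0 e0 (invr_neq0 a0)) => r0.
      by rewrite -root_r r0 expr0n !add0r.
    have /shift/eqP : p.[c + e / (a * r)] = p.[c]; last first.
      by rewrite !mulf_eq0 invr_eq0 mulf_eq0 (negPf e0) (negPf a0) (negPf r0).
    apply/eqP; rewrite -(add_eq0_char2 cardF); apply/eqP.
    transitivity ((e / (a * r)) ^+ 3 * (a ^+ 2 / e) * (r ^+ 2 + r + e / a)).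
      by rewrite !pE p1E p2E -ea; field_char2 K.
    by rewrite root_r mulr0.
  (* The new denominator is [p + p(c)], so [c] is now sent to infinity; [k] normalizes the constant
     numerator. *)
  set k := e ^+ 2 / a / q`_0; set l := p.[c] / q`_0.
  have k0 : k != 0 by rewrite !mulf_neq0 ?expf_neq0 ?invr_neq0.
  have pen' : pencil f (0 *: p + k *: q) (1 *: p + l *: q).
    apply: (pencil_comb two0F) pen.
    by rewrite mul0r mulr1 sub0r oppr_eq0.
  have ae0 : a / e != 0 by rewrite mulf_neq0 ?invr_neq0.
  have mm : is_moebius (((c * (a / e)) *: 'X + 1%:P)%:F / ((a / e) *: 'X + 0%:P)%:F).
    by exists (c * (a / e)), 1, (a / e), 0; rewrite mulr0 mul1r sub0r oppr_eq0.
  have := ratfun_equiv_pencil pen' mm.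
  have -> : 0 *: p + k *: q = (e ^+ 2 / a)%:P.
    by rewrite scale0r add0r {1}qc -mul_polyC -polyCM /k divfK.
  have [_ sz _ _] := pencil_cross deg3 inj pen'.
  rewrite map_polyC hornerC (ev4 _ sz) !linE cubic_formE.
  have lq : l * q`_0 = p.[c] by rewrite /l divfK.
  rewrite !coefD !coefZ !mul1r q1 q2 q3 !mulr0 !(@addr0 F) lq p1E p2E -ea.
  have -> : p`_0 + p.[c] = (e + a * c ^+ 2) * c + a * (c + 1) * c ^+ 2 + a * c ^+ 3.
    by rewrite pE p1E p2E -ea; ring_char2 K.
  have x0 : 'X%:F != 0 :> ratfun F by rewrite tofrac_eq0 polyX_eq0.
  have E := cubic_polynomial_form (@FracField.tofrac {poly F} \o polyC)
    c two0_ratfun a0 e0 x0.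
  by move=> equiv; exact: (eq_ind _ (ratfun_equiv f) equiv _ E).
(* Otherwise [q] would be inseparable and, square roots existing in F, have a root. *)
have q1 : q`_1 != 0.
  apply/eqP=> q1; have [r er] := sqrt_exists n_gt0 cardF (q`_0 / q`_2).
  by have := q_neq0 r; rewrite qE q1 er; case/eqP; field_char2 K.
(* Scaling the variable by [u] equalizes the two upper coefficients of [q], and [d] makes them 1;
   [k] makes the numerator monic and [l] removes its constant term. *)
have [u eu] : exists u, u = q`_1 / q`_2 by exists (q`_1 / q`_2).
have u0 : u != 0 by rewrite eu mulf_neq0 ?invr_neq0.
pose k := 1 / (p`_3 * u ^+ 3); pose l := p`_0 / (p`_3 * u ^+ 3) / q`_0.
pose d := q`_2 / q`_1 ^+ 2.
have pen' : pencil f (k *: p + l *: q) (0 *: p + d *: q).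
  apply: (pencil_comb two0F) pen; rewrite mulr0 subr0.
  by rewrite !mulf_neq0 ?invr_neq0 ?mulf_neq0 ?expf_neq0 ?oner_neq0.
have mm : is_moebius ((u *: 'X + 0%:P)%:F / (0 *: 'X + 1%:P)%:F).
  by exists u, 0, 0, 1; rewrite mulr0 mulr1 subr0.
have [szp szq _ _] := pencil_cross deg3 inj pen'.
have := ratfun_equiv_pencil pen' mm; rewrite (ev4 _ szp) (ev4 _ szq) !linE.
rewrite (scaled_cubic_form _ _ _ erefl erefl _ erefl) => [equiv|||||].
- exists ((k *: p + l *: q)`_1 * u), ((k *: p + l *: q)`_2 * u ^+ 2), (0 *: p + d *: q)`_0.
  rewrite cubic_formE; split=> //.
  apply/(noroot_trace2 n_gt0 cardF) => r; have := q_neq0 (u * r).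
  apply: contra_neq => root_r.
  transitivity (q`_1 ^+ 2 / q`_2 * (r ^+ 2 + r + (0 *: p + d *: q)`_0)).
    by rewrite coefD !coefZ qE eu /d; field_char2 K.
  by rewrite root_r mulr0.
- by rewrite coefD !coefZ /k /l; field_char2 K.
- by rewrite coefD !coefZ /k /l q3; field_char2 K.
- by rewrite coefD !coefZ /d eu; field_char2 K.
- by rewrite coefD !coefZ /d eu; field_char2 K.
- by rewrite coefD !coefZ q3 mulr0 mul0r addr0.
Qed.

(** * The permutation criterion for the cubic form *)

Section CubicForm.

Variables a1 a2 b : F.

Let N : {poly F} := 'X^3 + a2 *: 'X^2 + a1 *: 'X.
Let D : {poly F} := 'X^2 + 'X + b%:P.

Let NE y : N.[y] = y ^+ 3 + a2 * y ^+ 2 + a1 * y.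
Proof. by rewrite /N !hornerE. Qed.

Let DE y : D.[y] = y ^+ 2 + y + b.
Proof. by rewrite /D !hornerE. Qed.

Let size_N : size N = 4%N.
Proof.
rewrite /N -addrA size_polyDl size_polyXn //.
apply: leq_ltn_trans (size_polyD _ _) _; rewrite gtn_max.
by rewrite !(leq_ltn_trans (size_scale_leq _ _)) ?size_polyX ?size_polyXn.
Qed.

Let size_D : size D = 3%N.
Proof.
rewrite /D -addrA size_polyDl size_polyXn // size_XaddC; done.
Qed.

Let D_neq0 : D != 0.
Proof. by rewrite -size_poly_eq0 size_D. Qed.

(** Cancelling a nonconstant common factor would lower the degree below 3. *)
Lemma coprimep_cubic_form : rdeg (cubic_form a1 a2 b) = 3%N -> coprimep N D.
Proof.
move=> deg3; rewrite coprimep_def; set g := gcdp N D.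
have N0 : N != 0 by rewrite -size_poly_eq0 size_N.
have g0 : g != 0 by rewrite gcdp_eq0 negb_and N0.
have gN : g %| N := dvdp_gcdl _ _.
have gD : g %| D := dvdp_gcdr _ _.
have cop : coprimep (N %/ g) (D %/ g) by rewrite coprimep_div_gcd ?N0.
have Dg0 : D %/ g != 0 by rewrite dvdp_div_eq0.
have fE : cubic_form a1 a2 b = (N %/ g)%:F / (D %/ g)%:F.
  rewrite /cubic_form -/N -/D -{1}(divpK gN) -{1}(divpK gD) !tofracM.
  by rewrite -mulf_div divff ?mulr1 // tofrac_eq0.
move: deg3; rewrite (rdeg_coprime cop Dg0 fE) !size_divp // size_N size_D.
by move: g0; rewrite -size_poly_gt0; move: (size g) => s; lia.
Qed.

(** Since deg N > deg D, infinity is fixed, and no finite point may go there: this is the condition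
    that D has no root. *)
Lemma cubic_form_inj_cross : coprimep N D ->
  injective (reval (cubic_form a1 a2 b)) <->
  (forall y z : F, (y ^+ 3 + a2 * y ^+ 2 + a1 * y) * (z ^+ 2 + z + b) =
    (z ^+ 3 + a2 * z ^+ 2 + a1 * z) * (y ^+ 2 + y + b) -> y = z) /\
  (forall y, y ^+ 2 + y + b != 0).
Proof.
move=> cop; rewrite (reval_inj_cross cop D_neq0 erefl) size_N size_D /=.
have [N3 D3] : N`_3 = 1 /\ D`_3 = 0 by rewrite /N /D !coefE /= !mulr0 !addr0.
split=> -[I1 I2]; split=> [y z|y].
- by rewrite -!NE -!DE; exact: I1.
- by apply/eqP=> Dy; apply: (I2 y); rewrite N3 D3 mulr0 DE Dy mulr0.
- by rewrite !NE !DE; exact: I1.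
- by rewrite N3 D3 mulr0 mul1r DE => /esym; apply/eqP.
Qed.

Lemma cubic_form_permutation :
  rdeg (cubic_form a1 a2 b) = 3%N /\ permutation_ratfun (cubic_form a1 a2 b) <->
  [/\ trace2 n b = 1, a1 = b + 1 / b & a2 = 1 + 1 / b].
Proof.
split=> [[deg3 /bij_inj inj]|[trb ea1 ea2]].
  have cop := coprimep_cubic_form deg3.
  have [I1 I2] := (cubic_form_inj_cross cop).1 inj.
  have trb := (noroot_trace2 n_gt0 cardF b).1 I2.
  have b0 : b != 0 by have := I2 0; rewrite expr0n !add0r.
  have eA := cubic_A_eq1 n_gt0 cardF trb I1.
  (* If [a2 = 1], then [a1 = b] and N = X D, so the function would reduce to X. *)
  have beta0 : b * (a2 + 1) != 0.
    rewrite mulf_neq0 // (add_eq0_char2 cardF); apply/eqP=> ea2.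
    have ea1 : a1 = b.
      transitivity (b + a1 + a2 + 1 + b); first by rewrite ea2; ring_char2 K.
      by rewrite eA two0F add0r.
    have ND : N = 'X * D.
      by rewrite /N /D ea2 ea1 scale1r !mulrDr -exprS -expr2 [_ * b%:P]mulrC mul_polyC.
    move: cop; rewrite ND coprimepMl coprimepp size_D andbF; done.
  have beta1 := cubic_beta_eq1 n_gt0 cardF trb I1 beta0.
  have ea2 : a2 = 1 + 1 / b.
    transitivity (b * (a2 + 1) / b + 1); first by field_char2 K.
    by rewrite beta1 addrC.
  split=> //; transitivity (b + a1 + a2 + (b + a2)); first by ring_char2 K.
  by rewrite eA ea2; ring_char2 K.
have nr := (noroot_trace2 n_gt0 cardF b).2 trb.
have b0 : b != 0 by have := nr 0; rewrite expr0n !add0r.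
(* The identity is checked in the fraction field, where [cubic_form_division] applies with X as the
   element. *)
have bezout : N + D * ('X + (1 / b)%:P) = 1.
  pose phi : {rmorphism F -> ratfun F} := @FracField.tofrac {poly F} \o polyC.
  have phib0 : phi b != 0 by rewrite fmorph_eq0.
  have phiV : phi (1 / b) = 1 / phi b by rewrite fmorph_div rmorph1.
  have phi2 : phi a2 = 1 + 1 / phi b by rewrite ea2 rmorphD rmorph1 phiV.
  have phi1 : phi a1 = phi b + 1 / phi b by rewrite ea1 rmorphD phiV.
  apply/eqP; rewrite -tofrac_eq tofracD tofracM (tofracD 'X).
  rewrite /N /D tofrac_cubic tofrac_quadratic.
  have := cubic_form_division two0_ratfun 'X%:F phib0.
  by rewrite -phi1 -phi2 -phiV => /= ->; rewrite tofrac1.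
have cop : coprimep N D.
  apply/Bezout_coprimepP; exists (1, 'X + (1 / b)%:P) => /=.
  by rewrite mul1r [_ * D]mulrC bezout eqpxx.
split; first by rewrite (rdeg_coprime cop D_neq0 erefl) size_N size_D.
apply: injF_bij; apply/(cubic_form_inj_cross cop); split=> // y z.
rewrite ea1 ea2; exact: (cubic_form_inj n_gt0 cardF trb).
Qed.

End CubicForm.

End CubicRatFun.

Unset Implicit Arguments.

Theorem theorem6p2 (n : nat) (F : finFieldType)
    (n_gt0 : (0 < n)%N) (cardF : #|F| = (2 ^ n)%N) :
  (forall phi : ratfun F, rdeg phi = 3%N -> permutation_ratfun phi ->
     exists a1 a2 b0 : F,
       trace2 n b0 = 1 /\ ratfun_equiv phi (cubic_form a1 a2 b0)) /\
  (forall a1 a2 b0 : F,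
     rdeg (cubic_form a1 a2 b0) = 3%N /\
       permutation_ratfun (cubic_form a1 a2 b0) <->
     [/\ trace2 n b0 = 1, a1 = b0 + 1 / b0 & a2 = 1 + 1 / b0]).
Proof.
split; first exact: cubic_permutation_equiv.
by move=> a1 a2 b0; exact: cubic_form_permutation.
Qed.
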